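(* Let $d$ be a positive integer and let $\{\mathbb{Q}_n\}_{n\ge 0}$ be a monic orthogonal polynomial system in $d$ variables satisfying the three term relation $$x_i\,\mathbb{Q}_n=\tilde A_{n,i}\,\mathbb{Q}_{n+1}+\tilde B_{n,i}\,\mathbb{Q}_n+\tilde C_{n,i}\,\mathbb{Q}_{n-1},\qquad n\ge 0,\ 1\le i\le d,\qquad \mathbb{Q}_{-1}=0 .$$ Let $M_n$, $n\ge 1$, be constant real matrices of size $r_n^d\times r_{n-1}^d$ with $\operatorname{rank}M_1=1$, and define recursively a polynomial system $\{\mathbb{P}_n\}_{n\ge 0}$ by $$\mathbb{P}_0=\mathbb{Q}_0,\qquad \mathbb{Q}_n=\mathbb{P}_n+M_n\,\mathbb{P}_{n-1},\quad n\ge 1 .$$ Let $A_{n,i}$, $B_{n,i}$ ($n\ge 0$) and $C_{n,i}$ ($n\ge 1$), $1\le i\le d$, be real matrices of respective sizes $r_n^d\times r_{n+1}^d$, $r_n^d\times r_n^d$ and $r_n^d\times r_{n-1}^d$. Then $\{\mathbb{P}_n\}_{n\ge0}$ is a monic orthogonal polynomial system satisfying the three term relation $$x_i\,\mathbb{P}_n=A_{n,i}\,\mathbb{P}_{n+1}+B_{n,i}\,\mathbb{P}_n+C_{n,i}\,\mathbb{P}_{n-1},\qquad n\ge0,\ 1\le i\le d,\qquad \mathbb{P}_{-1}=0,$$ if and only if, for all $1\le i\le d$, $$M_n\,C_{n-1,i}=\tilde C_{n,i}\,M_{n-1},\qquad n\ge 2,$$ and $$A_{n,i}=\tilde A_{n,i}=L_{n,i},\qquad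 n\ge 0,$$ $$B_{n,i}=\tilde B_{n,i}-M_nA_{n-1,i}+\tilde A_{n,i}M_{n+1},\qquad n\ge 0,$$ $$C_{n,i}=\tilde C_{n,i}-M_nB_{n-1,i}+\tilde B_{n,i}M_n,\qquad n\ge 1,$$ where, by convention $M_0=0$, the term $M_nA_{n-1,i}$ is $0$ for $n=0$.
   Context: $\Pi^d$ is the space of real polynomials in $d$ variables $\mathtt{x}=(x_1,\dots,x_d)$, and $\Pi^d_n$ its subspace of polynomials of total degree at most $n$ (with $\Pi^d_{-1}=\{0\}$). $r_n^d=\binom{n+d-1}{d-1}$ is the number of monomials of total degree $n$. $\mathbb{X}_n$ is the column vector of all monomials $\mathtt{x}^\alpha$, $|\alpha|=n$, arranged in reverse lexicographical order (for $d=2$: $x_1^n,x_1^{n-1}x_2,\dots,x_2^n$). $L_{n,i}$ is the $r_n^d\times r_{n+1}^d$ matrix defined by $L_{n,i}\,\mathbb{X}_{n+1}=x_i\,\mathbb{X}_n$, $1\le i\le d$. A polynomial system (PS) is a sequence $\{\mathbb{P}_n\}_{n\ge0}$ where $\mathbb{P}_n$ is a column vector of $r_n^d$ polynomials of total degree $n$ that are linearly independent modulo $\Pi^d_{n-1}$. It is monic if, for every $n\ge 0$, all entries of $\mathbb{P}_n-\mathbb{X}_n$ lie in $\Pi^d_{n-1}$ (in particular $\mathbb{P}_0=1$). A moment functional is a linear functional $u:\Pi^d\to\mathbb{R}$; it acts entrywise on matrices of polynomials. A PS $\{\mathbb{P}_n\}_{n\ge 0}$ is an orthogonal polynomial system (OPS)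 with respect to $u$ if $\langle u,\mathbb{P}_n\mathbb{P}_m^t\rangle=0$ for $n\ne m$ and $\langle u,\mathbb{P}_n\mathbb{P}_n^t\rangle=H_n$ is a (symmetric) non-singular matrix for all $n\ge 0$. A monic orthogonal polynomial system is a monic PS that is an OPS with respect to some moment functional. For a monic orthogonal polynomial system $\{\mathbb{Q}_n\}_{n\ge0}$, the coefficients in its three term relation are real matrices $\tilde A_{n,i},\tilde B_{n,i},\tilde C_{n,i}$ of sizes $r_n^d\times r_{n+1}^d$, $r_n^d\times r_n^d$, $r_n^d\times r_{n-1}^d$, and they satisfy the rank conditions $\operatorname{rank}\tilde A_{n,i}=\operatorname{rank}\tilde C_{n+1,i}=r_n^d$ for $1\le i\le d$, $n\ge0$, and $\operatorname{rank}(\tilde A_{n,1}^t,\dots,\tilde A_{n,d}^t)^t=\operatorname{rank}(\tilde C_{n+1,1},\dots,\tilde C_{n+1,d})^t=r_{n+1}^d$ (these always hold for an OPS). *)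

(* Defs.v *)
From HB Require Import structures.
From mathcomp Require Export all_boot all_order all_algebra.
From mathcomp Require Export reals.
From mathcomp Require Export mpoly.

Set Implicit Arguments.
Unset Strict Implicit.
Unset Printing Implicit Defensive.

Import Order.TTheory GRing.Theory Num.Theory.

Open Scope ring_scope.

(* r_n^d, for d > 0 *)
Definition rdim (d n : nat) : nat := 'C(n + d - 1, d - 1).

(* On monomials of equal degree, <=%O is (despite the header of mpoly.v) the
   lexicographic order on exponents, x_1 first; the list is decreasing for it.
   Thus for d = 2: x_1^n, x_1^(n-1) x_2, ..., x_2^n. *)
Definition monomials (d n : nat) : seq 'X_{1..d} :=
  sort (fun a b => (b <= a)%O)
    [seq bmnm m | m : 'X_{1..d < n.+1} <- enum {: 'X_{1..d < n.+1}} & mdeg m == n].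

Definition monom (d n : nat) (j : 'I_(rdim d n)) : 'X_{1..d} :=
  nth 0%MM (monomials d n) j.

Definition Xvec (R : realType) (d n : nat) : 'cV[{mpoly R[d]}]_(rdim d n) :=
  \col_j 'X_[monom j].

(* L_{n,i}; see Lmx_Xvec and Lmx_unique for the defining property. *)
Definition Lmx (R : realType) (d n : nat) (i : 'I_d) :
    'M[R]_(rdim d n, rdim d n.+1) :=
  \matrix_(j, k) ((monom j + U_(i))%MM == monom k)%:R.

(* product of a constant matrix and a vector of polynomials *)
Definition pmulmx (R : realType) (d m n : nat) (A : 'M[R]_(m, n))
    (P : 'cV[{mpoly R[d]}]_n) : 'cV[{mpoly R[d]}]_m :=
  map_mx (@mpolyC d R) A *m P.

Notation "A *mp P" := (pmulmx A P) (at level 40, left associativity).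

(* msize p <= n means that p has total degree at most n - 1, i.e. that p lies
   in Pi^d_{n-1}; for n = 0 it means p = 0. *)
Definition is_PS (R : realType) (d : nat)
    (P : forall n, 'cV[{mpoly R[d]}]_(rdim d n)) : Prop :=
  forall n,
    (forall j, msize (P n j 0) = n.+1) /\
    (forall c : 'rV[R]_(rdim d n),
       (msize ((c *mp P n) 0 0)%R <= n)%N -> c = 0).

Definition is_monic_PS (R : realType) (d : nat)
    (P : forall n, 'cV[{mpoly R[d]}]_(rdim d n)) : Prop :=
  is_PS P /\ forall n j, (msize ((P n - Xvec R d n) j 0)%R <= n)%N.

Definition is_OPS (R : realType) (d : nat) (u : {scalar {mpoly R[d]}})
    (P : forall n, 'cV[{mpoly R[d]}]_(rdim d n)) : Prop :=
  [/\ is_PS P,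
      forall n m, n != m -> map_mx u (P n *m (P m)^T) = 0
    & forall n, map_mx u (P n *m (P n)^T) \in unitmx].

Definition is_monic_OPS (R : realType) (d : nat)
    (P : forall n, 'cV[{mpoly R[d]}]_(rdim d n)) : Prop :=
  is_monic_PS P /\ exists u : {scalar {mpoly R[d]}}, is_OPS u P.

(* P_{n-1}, with P_{-1} = 0. As in the types of C and M below, the index n.-1
   makes the case n = 0 a dummy of size r_0 which only ever meets this 0. *)
Definition prevPS (R : realType) (d : nat)
    (P : forall n, 'cV[{mpoly R[d]}]_(rdim d n)) (n : nat) :
    'cV[{mpoly R[d]}]_(rdim d n.-1) :=
  match n with 0 => 0 | m.+1 => P m end.

Definition three_term (R : realType) (d : nat)
    (P : forall n, 'cV[{mpoly R[d]}]_(rdim d n))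
    (A : forall n, 'I_d -> 'M[R]_(rdim d n, rdim d n.+1))
    (B : forall n, 'I_d -> 'M[R]_(rdim d n))
    (C : forall n, 'I_d -> 'M[R]_(rdim d n, rdim d n.-1)) : Prop :=
  forall n (i : 'I_d),
    'X_i *: P n = A n i *mp P n.+1 + B n i *mp P n + C n i *mp prevPS P n.

(* M_n A_{n-1,i}, equal to 0 for n = 0 *)
Definition mulMAprev (R : realType) (d : nat)
    (M : forall n, 'M[R]_(rdim d n, rdim d n.-1))
    (A : forall n, 'I_d -> 'M[R]_(rdim d n, rdim d n.+1))
    (n : nat) (i : 'I_d) : 'M[R]_(rdim d n) :=
  match n with 0 => 0 | m.+1 => M m.+1 *m A m i end.

Lemma mem_monomials d n (m : 'X_{1..d}) :
  (m \in monomials d n) = (mdeg m == n).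
Proof.
rewrite mem_sort; apply/mapP/idP => [[b]|/eqP dm].
  by rewrite mem_filter => /andP[bn _] ->.
have mlt : (mdeg m < n.+1)%N by rewrite dm.
by exists (BMultinom mlt) => //; rewrite mem_filter /= dm eqxx mem_enum.
Qed.

Lemma uniq_monomials d n : uniq (monomials d n).
Proof.
rewrite sort_uniq map_inj_uniq; last exact: val_inj.
by rewrite filter_uniq // enum_uniq.
Qed.

Lemma size_monomials d n : (0 < d)%N -> size (monomials d n) = rdim d n.
Proof.
case: d => // d _; rewrite /rdim addnS !subn1 /=.
rewrite [RHS](_ : _ = 'C(n + d, n)); last by rewrite -bin_sub ?leq_addl ?addnK.
rewrite -size_basis; apply/perm_size/uniq_perm.
- exact: uniq_monomials.
- exact: uniq_basis.
- by move=> m; rewrite mem_monomials basis_cover.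
Qed.

Lemma mdeg_monom d n (j : 'I_(rdim d n)) : (0 < d)%N -> mdeg (monom j) = n.
Proof.
move=> d0; apply/eqP; rewrite -mem_monomials mem_nth //.
by rewrite size_monomials.
Qed.

Lemma monom_inj d n : (0 < d)%N -> injective (@monom d n).
Proof.
move=> d0 j k /eqP; rewrite nth_uniq ?uniq_monomials ?size_monomials //.
by move/eqP/val_inj.
Qed.

Lemma monom_surj d n (m : 'X_{1..d}) :
  (0 < d)%N -> mdeg m = n -> exists j : 'I_(rdim d n), monom j = m.
Proof.
move=> d0 /eqP; rewrite -mem_monomials => mn.
have lt : (index m (monomials d n) < rdim d n)%N.
  by rewrite -(size_monomials _ d0) index_mem.
by exists (Ordinal lt); rewrite /monom /= nth_index.
Qed.

Lemma Lmx_Xvec (R : realType) d n (i : 'I_d) :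
  Lmx R n i *mp Xvec R d n.+1 = 'X_i *: Xvec R d n.
Proof.
have d0 : (0 < d)%N by case: d i => // [[]].
apply/matrixP => j k; rewrite !mxE.
have [l hl] : exists l : 'I_(rdim d n.+1), monom l = (monom j + U_(i))%MM.
  by apply: monom_surj; rewrite // mdegD mdeg1 mdeg_monom // addn1.
rewrite (bigD1 l) //= big1 => [|l' nl]; rewrite !mxE -hl.
  by rewrite eqxx mpolyC1 mul1r addr0 hl mpolyXD mulrC.
rewrite (inj_eq (@monom_inj _ _ d0)) eq_sym (negbTE nl).
by rewrite mpolyC0 mul0r.
Qed.

Lemma Lmx_unique (R : realType) d n (i : 'I_d)
    (L : 'M[R]_(rdim d n, rdim d n.+1)) :
  L *mp Xvec R d n.+1 = 'X_i *: Xvec R d n -> L = Lmx R n i.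
Proof.
have d0 : (0 < d)%N by case: d i L => // [[]].
rewrite -Lmx_Xvec => /matrixP E; apply/matrixP => j k.
have coef (N : 'M[R]_(rdim d n, rdim d n.+1)) :
    ((N *mp Xvec R d n.+1) j 0)@_(monom k) = N j k.
  rewrite !mxE raddf_sum (bigD1 k) //= big1 => [|l nl]; rewrite !mxE mcoeffCM mcoeffX.
    by rewrite eqxx mulr1 addr0.
  by rewrite (inj_eq (@monom_inj _ _ d0)) (negbTE nl) mulr0.
by rewrite -(coef L) -(coef (Lmx R n i)) E.
Qed.

(* Main.v *)
From HB Require Import structures.
Require Import Defs.
From mathcomp Require Import ring.

Set Implicit Arguments.
Unset Strict Implicit.
Unset Printing Implicit Defensive.

Import Order.TTheory GRing.Theory.

(** The four matrix relations say that two expansions of [x_i Q_{n+1}] in the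
    system [P] have the same coefficients: one uses the three term relation of
    [Q], the other the candidate relation of [P] ([residualS]). If [P] is
    orthogonal, its entries are independent, so the coefficients agree.
    Conversely, if the coefficients agree, the defect [E_n] of the candidate
    relation satisfies [E_0 = 0] and [E_{n+1} = - M_{n+1} E_n], so [P] has a
    three term relation.

    It remains to produce a moment functional for [P]. Let [u] be the functional
    with [u(P_0) = 1] and [u(P_n) = 0] for [n >= 1]. The three term relation
    makes [P_n] and [P_m] orthogonal for [n <> m]; the issue is to show that
    [H_n = u(P_n P_n^t)] is nonsingular. Write [K_n] for the Gram matrices of
    [Q]. Orthogonality gives
<<
       H_{n+1} L_{n,i}^t = C_{n+1,i} H_n,   Ct_{n+1,i} = K_{n+1} L_{n,i}^t K_n^-1.
>>
    With [N_n = M_{n+1}^t K_{n+1}^-1], the second formula turns the hypothesis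
    [M_{n+2} C_{n+1,i} = Ct_{n+2,i} M_{n+1}] into
<<
       C_{n+1,i}^t N_{n+1} = N_n L_{n+1,i}.
>>
    The matrix [N_0] has a single row, which holds the coefficients of a linear
    form [l], nonzero because [M_1] is. Let [T_n] be the matrix of multiplication
    by [l] from degree [n] to degree [n+1]; it commutes with multiplication by
    the variables, [T_n L_{n+1,i} = L_{n,i} T_{n+1}], and is injective.
    By induction the rows of [N_n] span exactly the multiples of [l], that is
    [N_n = G_n T_n] with [G_n] invertible, and cancelling [T_{n+1}] leaves
    [C_{n+1,i}^t G_{n+1} = G_n L_{n,i}] ([factor_through_form]).
    Comparing with the recurrence for [H_n], and using that the [L_{n,i}] are
    jointly of full rank, gives [G_n^t H_n = 1] for all [n] ([gram_unit]). *)

Local Notation pvec R d n := 'cV[{mpoly R[d]}]_(rdim d n) (only parsing).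

(** * Constant matrices acting on vectors of polynomials *)

Lemma pmulmxDl (R : realType) (d m n : nat) (A B : 'M[R]_(m, n))
    (P : 'cV[{mpoly R[d]}]_n) : (A + B) *mp P = A *mp P + B *mp P.
Proof. by rewrite /pmulmx map_mxD mulmxDl. Qed.

Lemma pmulmxBl (R : realType) (d m n : nat) (A B : 'M[R]_(m, n))
    (P : 'cV[{mpoly R[d]}]_n) : (A - B) *mp P = A *mp P - B *mp P.
Proof. by rewrite /pmulmx map_mxB mulmxBl. Qed.

Lemma pmulmxDr (R : realType) (d m n : nat) (A : 'M[R]_(m, n))
    (P Q : 'cV[{mpoly R[d]}]_n) : A *mp (P + Q) = A *mp P + A *mp Q.
Proof. by rewrite /pmulmx mulmxDr. Qed.

Lemma pmulmxBr (R : realType) (d m n : nat) (A : 'M[R]_(m, n))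
    (P Q : 'cV[{mpoly R[d]}]_n) : A *mp (P - Q) = A *mp P - A *mp Q.
Proof. by rewrite /pmulmx mulmxBr. Qed.

Lemma pmulNmx (R : realType) (d m n : nat) (A : 'M[R]_(m, n))
    (P : 'cV[{mpoly R[d]}]_n) : (- A) *mp P = - (A *mp P).
Proof. by rewrite /pmulmx map_mxN mulNmx. Qed.

Lemma pmulmxN (R : realType) (d m n : nat) (A : 'M[R]_(m, n))
    (P : 'cV[{mpoly R[d]}]_n) : A *mp (- P) = - (A *mp P).
Proof. by rewrite /pmulmx mulmxN. Qed.

Lemma pmulmx0 (R : realType) (d m n : nat) (A : 'M[R]_(m, n)) :
  A *mp (0 : 'cV[{mpoly R[d]}]_n) = 0.
Proof. by rewrite /pmulmx mulmx0. Qed.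

Lemma pmul0mx (R : realType) (d m n : nat) (P : 'cV[{mpoly R[d]}]_n) :
  (0 : 'M[R]_(m, n)) *mp P = 0.
Proof. by rewrite /pmulmx map_mx0 mul0mx. Qed.

Lemma pmulmxA (R : realType) (d m n p : nat) (A : 'M[R]_(m, n))
    (B : 'M[R]_(n, p)) (P : 'cV[{mpoly R[d]}]_p) :
  (A *m B) *mp P = A *mp (B *mp P).
Proof. by rewrite /pmulmx map_mxM mulmxA. Qed.

Lemma pmulmxZr (R : realType) (d m n : nat) (A : 'M[R]_(m, n))
    (q : {mpoly R[d]}) (P : 'cV[{mpoly R[d]}]_n) :
  A *mp (q *: P) = q *: (A *mp P).
Proof. by rewrite /pmulmx scalemxAr. Qed.

(** * Degrees and leading coefficients *)

Lemma msize_leP (R : realType) (d n : nat) (p : {mpoly R[d]}) :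
  (msize p <= n)%N <-> (forall m : 'X_{1..d}, (n <= mdeg m)%N -> p@_m = 0).
Proof.
split=> [pn m nm | p0].
  exact: memN_msupp_eq0 (msize_mdeg_ge (leq_trans pn nm)).
rewrite msizeE big_seq; elim/big_ind: _ => // [x y|m mp].
  by rewrite geq_max => -> ->.
rewrite ltnNge; apply/negP => /p0 /eqP; apply/negP.
by rewrite -mcoeff_msupp.
Qed.

Lemma pmulmx_low (R : realType) (d k m n : nat) (K : 'M[R]_(m, n))
    (P : 'cV[{mpoly R[d]}]_n) :
  (forall j, (msize (P j 0)%R <= k)%N) ->
  forall j, (msize ((K *mp P) j 0)%R <= k)%N.
Proof.
move=> Pk j; apply/msize_leP => a ka; rewrite mxE raddf_sum big1 // => l _ /=.
by rewrite mxE mcoeffCM; have /msize_leP -> := Pk l; rewrite ?mulr0.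
Qed.

Lemma mcoeff_pmulmx_Xvec (R : realType) (d m n : nat)
    (K : 'M[R]_(m, rdim d n)) j k :
  (0 < d)%N -> ((K *mp Xvec R d n) j 0)@_(monom k) = K j k.
Proof.
move=> d0; rewrite !mxE raddf_sum (bigD1 k) //= big1 => [|l nl].
  by rewrite !mxE mcoeffCM mcoeffX eqxx mulr1 addr0.
by rewrite !mxE mcoeffCM mcoeffX (inj_eq (@monom_inj _ _ d0)) (negbTE nl) mulr0.
Qed.

(** The entries of [K *mp Xvec] are homogeneous of degree [n], so they vanish
    as soon as their degree is smaller. *)
Lemma pmulmx_Xvec_low_eq0 (R : realType) (d m n : nat)
    (K : 'M[R]_(m, rdim d n)) : (0 < d)%N ->
  (forall j, (msize ((K *mp Xvec R d n) j 0)%R <= n)%N) -> K = 0.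
Proof.
move=> d0 Kn; apply/matrixP => j k; rewrite -(mcoeff_pmulmx_Xvec K j k d0) [RHS]mxE.
by have /msize_leP -> := Kn j; rewrite ?mdeg_monom.
Qed.

Lemma pmulmx_Xvec_inj (R : realType) (d m n : nat) (A B : 'M[R]_(m, rdim d n)) :
  (0 < d)%N -> A *mp Xvec R d n = B *mp Xvec R d n -> A = B.
Proof.
by move=> d0 AB; apply/matrixP => j k; rewrite -!(mcoeff_pmulmx_Xvec _ _ _ d0) AB.
Qed.

Lemma entry_lead (R : realType) (d n : nat) (V : pvec R d n) j :
  V j 0 = 'X_[monom j] + (V - Xvec R d n) j 0.
Proof. by rewrite !mxE addrCA subrr addr0. Qed.

Lemma msize_of_lead (R : realType) (d n : nat) (V : pvec R d n) :
  (0 < d)%N -> (forall j, (msize ((V - Xvec R d n) j 0)%R <= n)%N) ->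
  forall j, (msize (V j 0)%R <= n.+1)%N.
Proof.
move=> d0 low j; apply/msize_leP => a na; rewrite entry_lead mcoeffD mcoeffX.
have /msize_leP -> := low j; last exact: ltnW.
rewrite addr0; case: eqP => // ja.
by move: na; rewrite -ja mdeg_monom // ltnn.
Qed.

Lemma mcoeff_lead (R : realType) (d n : nat) (V : pvec R d n) j k :
  (0 < d)%N -> (forall j, (msize ((V - Xvec R d n) j 0)%R <= n)%N) ->
  (V j 0)@_(monom k) = (j == k)%:R.
Proof.
move=> d0 low; rewrite entry_lead mcoeffD mcoeffX (inj_eq (@monom_inj _ _ d0)).
by have /msize_leP -> := low j; rewrite ?addr0 ?mdeg_monom.
Qed.

(** A vector with the right leading parts is automatically independent modulo
    lower degrees, because the monomials are: hence monic systems can be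
    recognized from their leading parts alone. *)
Lemma monic_PS_of_lead (R : realType) (d : nat) (P : forall n, pvec R d n) :
  (0 < d)%N -> (forall n j, (msize ((P n - Xvec R d n) j 0)%R <= n)%N) ->
  is_monic_PS P.
Proof.
move=> d0 low; split=> // n.
split=> [j | c cn].
  apply/eqP; rewrite eqn_leq (msize_of_lead d0 (low n)) ltnNge /=.
  apply/negP => /msize_leP /(_ (monom j)); rewrite mdeg_monom //.
  rewrite (mcoeff_lead j j d0 (low n)) eqxx => /(_ (leqnn _)) /eqP.
  by rewrite oner_eq0.
apply: (pmulmx_Xvec_low_eq0 d0) => j; rewrite (ord1 j).
have -> : Xvec R d n = P n - (P n - Xvec R d n) by rewrite subKr.
rewrite pmulmxBr; apply/msize_leP => a na; rewrite !mxE -/(pmulmx _ _) mcoeffB.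
have /msize_leP := cn => /(_ a na); rewrite mxE => ->.
have /msize_leP := pmulmx_low c (low n) 0 => /(_ a na).
by rewrite mxE => ->; rewrite subr0.
Qed.

(** Comparing the homogeneous parts of degree [n + 1] in the three term
    relation leaves the defining relation of [Lmx]. *)
Lemma monic_three_term_lead (R : realType) (d : nat) (P : forall n, pvec R d n)
    (A : forall n, 'I_d -> 'M[R]_(rdim d n, rdim d n.+1))
    (B : forall n, 'I_d -> 'M[R]_(rdim d n))
    (C : forall n, 'I_d -> 'M[R]_(rdim d n, rdim d n.-1)) :
  (0 < d)%N -> is_monic_PS P -> three_term P A B C ->
  forall n i, A n i = Lmx R n i.
Proof.
move=> d0 [PS low] tt n i; apply/eqP; rewrite -subr_eq0; apply/eqP.
apply: (pmulmx_Xvec_low_eq0 d0) => j.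
pose D m := P m - Xvec R d m.
have XE m : Xvec R d m = P m - D m by rewrite subKr.
have Pm m k : (msize (P m k 0)%R <= m.+1)%N by rewrite (PS m).1.
have -> : (A n i - Lmx R n i) *mp Xvec R d n.+1 =
   'X_i *: D n - (A n i *mp D n.+1 + B n i *mp P n + C n i *mp prevPS P n).
  rewrite pmulmxBl Lmx_Xvec !XE pmulmxBr scalerBr tt.
  by rewrite /D !opprB; apply/matrixP => ? ?; rewrite !mxE; ring.
have preP m k : (msize (prevPS P m k 0)%R <= m.+1)%N.
  by case: m k => [|m] k /=; rewrite ?mxE ?msize0 //; apply: leqW.
have Xlow : (msize (('X_i *: D n) j 0)%R <= n.+1)%N.
  rewrite mxE; have [->|nz] := eqVneq (D n j 0) 0; first by rewrite mulr0 msize0.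
  have Xnz : 'X_i != 0 :> {mpoly R[d]}.
    by apply/eqP => /(congr1 (fun p => msize p)); rewrite msizeX msize0.
  by rewrite msizeM // msizeX mdeg1 ltnS low.
have entryE (U V W Z : pvec R d n) :
    (U - (V + W + Z)) j 0 = U j 0 - (V j 0 + W j 0 + Z j 0).
  by rewrite !mxE.
apply/msize_leP => a na; rewrite entryE mcoeffB !mcoeffD.
have /msize_leP -> // := Xlow.
have /msize_leP -> // := pmulmx_low (A n i) (low n.+1) j.
have /msize_leP -> // := pmulmx_low (B n i) (Pm n) j.
have /msize_leP -> // := pmulmx_low (C n i) (preP n) j.
by rewrite !addr0 subr0.
Qed.

(** * Moment functionals *)

Lemma map_mx_mpolyCM (R : realType) (d m n p : nat)
    (u : {scalar {mpoly R[d]}}) (K : 'M[R]_(m, n)) (Y : 'M[{mpoly R[d]}]_(n, p)) :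
  map_mx u (map_mx (@mpolyC d R) K *m Y) = K *m map_mx u Y.
Proof.
apply/matrixP => j k; rewrite !mxE raddf_sum; apply: eq_bigr => l _ /=.
by rewrite !mxE mul_mpolyC linearZ.
Qed.

(** At [n = m] this is the matrix [H_n] of an orthogonal system. *)
Definition gram (R : realType) (d : nat) (u : {scalar {mpoly R[d]}})
    (P : forall n, pvec R d n) (n m : nat) : 'M[R]_(rdim d n, rdim d m) :=
  map_mx u (P n *m (P m)^T).

Lemma gram_tr (R : realType) (d : nat) (u : {scalar {mpoly R[d]}})
    (P : forall n, pvec R d n) n m : (gram u P n m)^T = gram u P m n.
Proof. by rewrite /gram map_trmx trmx_mul trmxK. Qed.

Lemma gram_pmulmx (R : realType) (d k n m : nat) (u : {scalar {mpoly R[d]}})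
    (P : forall n, pvec R d n) (K : 'M[R]_(k, rdim d n)) :
  map_mx u ((K *mp P n) *m (P m)^T) = K *m gram u P n m.
Proof. by rewrite -mulmxA map_mx_mpolyCM. Qed.

(** Both sides are [u (x_i P_{n+1} P_n^t)], with [x_i] absorbed once by each
    factor. *)
Lemma gram_three_term (R : realType) (d : nat) (u : {scalar {mpoly R[d]}})
    (P : forall n, pvec R d n)
    (A : forall n, 'I_d -> 'M[R]_(rdim d n, rdim d n.+1))
    (B : forall n, 'I_d -> 'M[R]_(rdim d n))
    (C : forall n, 'I_d -> 'M[R]_(rdim d n, rdim d n.-1)) :
  (forall n m, n != m -> gram u P n m = 0) -> three_term P A B C ->
  forall n i, gram u P n.+1 n.+1 *m (A n i)^T = C n.+1 i *m gram u P n n.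
Proof.
move=> orth tt n i.
have prev0 : map_mx u (prevPS P n *m (P n.+1)^T) = 0.
  case: n => [|n]; first by rewrite mul0mx map_mx0.
  by apply: orth; rewrite neq_ltn leqW.
transitivity (map_mx u (('X_i *: P n.+1) *m (P n)^T)).
  have -> : ('X_i *: P n.+1) *m (P n)^T = (('X_i *: P n) *m (P n.+1)^T)^T.
    by rewrite trmx_mul trmxK linearZ /= -scalemxAl -scalemxAr.
  rewrite -map_trmx tt !mulmxDl !map_mxD !gram_pmulmx.
  rewrite -mulmxA map_mx_mpolyCM prev0 mulmx0 addr0.
  rewrite (orth n n.+1) ?mulmx0 ?addr0; last by rewrite neq_ltn leqnn.
  by rewrite trmx_mul gram_tr.
rewrite tt !mulmxDl !map_mxD !gram_pmulmx /=.
rewrite (orth n.+2 n) ?(orth n.+1 n) ?mulmx0 ?add0r //.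
  by rewrite neq_ltn leqnn orbT.
by rewrite neq_ltn leqW ?orbT.
Qed.

(** Each multiplication by a variable lowers the index of [P n] by at most one,
    so a product of fewer than [n] variables cannot bring it down to [P 0],
    the only place where [u] does not vanish. *)
Lemma three_term_monomial (R : realType) (d : nat) (u : {scalar {mpoly R[d]}})
    (P : forall n, pvec R d n)
    (A : forall n, 'I_d -> 'M[R]_(rdim d n, rdim d n.+1))
    (B : forall n, 'I_d -> 'M[R]_(rdim d n))
    (C : forall n, 'I_d -> 'M[R]_(rdim d n, rdim d n.-1)) :
  (forall n, map_mx u (P n.+1) = 0) -> three_term P A B C ->
  forall (a : 'X_{1..d}) n, (mdeg a < n)%N -> map_mx u ('X_[a] *: P n) = 0.
Proof.
move=> uP tt a n; move Ek: (mdeg a) => k; elim: k a n Ek => [|k IH] a [|n] // ak kn.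
  by move/eqP: ak; rewrite mdeg_eq0 => /eqP ->; rewrite mpolyX0 scale1r.
have [i ai] : exists i, a i != 0%N.
  apply/existsP; rewrite -negb_forall; apply/negP => /forallP a0.
  have a00 : a = 0%MM by apply/mnmP => i; rewrite mnm0E; apply/eqP.
  by move: ak; rewrite a00 mdeg0.
have ui : (U_(i) <= a)%MM by rewrite lep1mP.
have bk : mdeg (a - U_(i))%MM = k.
  by apply/succn_inj; rewrite -ak -{2}(submK ui) mdegD mdeg1 addn1.
rewrite -(submK ui) mpolyXD -scalerA tt !scalerDr -!pmulmxZr !map_mxD.
rewrite !map_mx_mpolyCM !(IH _ _ bk) ?mulmx0 ?addr0 //.
  exact: ltnW.
by do 2!apply: ltnW.
Qed.

(** The easy half of Favard's theorem: the relation and the vanishing of [u] on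
    [P n] for [n >= 1] force orthogonality, but say nothing yet about the
    diagonal Gram matrices. *)
Lemma three_term_orthogonal (R : realType) (d : nat) (u : {scalar {mpoly R[d]}})
    (P : forall n, pvec R d n)
    (A : forall n, 'I_d -> 'M[R]_(rdim d n, rdim d n.+1))
    (B : forall n, 'I_d -> 'M[R]_(rdim d n))
    (C : forall n, 'I_d -> 'M[R]_(rdim d n, rdim d n.-1)) :
  is_PS P -> (forall n, map_mx u (P n.+1) = 0) -> three_term P A B C ->
  forall n m, n != m -> gram u P n m = 0.
Proof.
move=> PS uP tt n m.
wlog nm : n m / (n < m)%N => [hw|_].
  rewrite neq_ltn => /orP[] lt; first by apply: hw; rewrite // neq_ltn lt.
  by rewrite -gram_tr hw ?trmx0 // neq_ltn lt.
apply/matrixP => j k; rewrite !mxE big_ord1 !mxE.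
(* The factor of lower degree is a combination of monomials of degree < m. *)
rewrite [P n j 0]mpolyE mulr_suml raddf_sum big_seq big1 // => a.
move/msize_mdeg_lt; rewrite (PS n).1 ltnS => an.
have /matrixP /(_ k 0) := three_term_monomial uP tt (leq_ltn_trans an nm).
by rewrite !mxE /= -scalerAl linearZ => /= ->; rewrite mulr0.
Qed.

(** Subtracts the combination of the entries of [P n] that cancels the part of
    degree [n]. *)
Definition reduce (R : realType) (d : nat) (P : forall n, pvec R d n) n
    (p : {mpoly R[d]}) : {mpoly R[d]} :=
  p - \sum_j p@_(monom j) *: P n j 0.

(** For [p] of degree at most [N], the coefficient of [P_0] in the expansion of
    [p] in a monic system [P]. *)
Fixpoint coord0 (R : realType) (d : nat) (P : forall n, pvec R d n) N
    (p : {mpoly R[d]}) : R :=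
  match N with 0 => p@_0 | N'.+1 => coord0 P N' (reduce P N p) end.

Lemma reduce_linear (R : realType) (d : nat) (P : forall n, pvec R d n) n a p q :
  reduce P n (a *: p + q) = a *: reduce P n p + reduce P n q.
Proof.
rewrite /reduce scalerBr scaler_sumr addrACA -opprD -big_split /=.
congr (_ - _); apply: eq_bigr => j _.
by rewrite mcoeffD mcoeffZ scalerDl scalerA.
Qed.

Lemma coord0_linear (R : realType) (d : nat) (P : forall n, pvec R d n) N a p q :
  coord0 P N (a *: p + q) = a * coord0 P N p + coord0 P N q.
Proof.
elim: N p q => [|N IH] p q; first by rewrite /= mcoeffD mcoeffZ.
by rewrite /= reduce_linear IH.
Qed.

Lemma reduce_low (R : realType) (d : nat) (P : forall n, pvec R d n) n p :
  (0 < d)%N -> (msize p <= n)%N -> reduce P n p = p.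
Proof.
move=> d0 pn; rewrite /reduce big1 ?subr0 // => j _.
have /msize_leP -> := pn; first by rewrite scale0r.
by rewrite mdeg_monom.
Qed.

Lemma coord0_stable (R : realType) (d : nat) (P : forall n, pvec R d n) N p :
  (0 < d)%N -> (msize p <= N)%N -> coord0 P N p = coord0 P (msize p) p.
Proof.
move=> d0 /subnK <-; elim: (N - msize p)%N => //= k <-.
by rewrite reduce_low // leqW // leq_addl.
Qed.

Lemma reduce_monic (R : realType) (d : nat) (P : forall n, pvec R d n) n j :
  (0 < d)%N -> is_monic_PS P -> reduce P n (P n j 0) = 0.
Proof.
move=> d0 [_ low].
rewrite /reduce (bigD1 j) //= big1 => [|k nk].
  by rewrite mcoeff_lead // eqxx scale1r addr0 subrr.
by rewrite mcoeff_lead // eq_sym (negbTE nk) scale0r.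
Qed.

(** A monic system is a basis of the polynomials, and [u] reads off the
    coefficient of [P_0 = 1]. *)
Lemma exists_dual_functional (R : realType) (d : nat) (P : forall n, pvec R d n) :
  (0 < d)%N -> is_monic_PS P ->
  exists u : {scalar {mpoly R[d]}},
    u 1 = 1 /\ forall n, map_mx u (P n.+1) = 0.
Proof.
move=> d0 mP; pose f p := coord0 P (msize p) p.
have fE N p : (msize p <= N)%N -> f p = coord0 P N p by move/(coord0_stable P d0).
have flin : linear_for *%R f.
  (* The number of reductions depends on the polynomial; a common one suffices. *)
  move=> a p q; pose N := maxn (msize (a *: p + q)) (maxn (msize p) (msize q)).
  by rewrite !(fE N) ?coord0_linear // /N !leq_max leqnn ?orbT.
pose u : {scalar {mpoly R[d]}} :=
  HB.pack f (GRing.isLinear.Build R {mpoly R[d]} R *%R f flin).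
have coord00 N : coord0 P N 0 = 0.
  have := coord0_linear P N (-1) 0 0.
  by rewrite scaler0 addr0 mulN1r addNr.
exists u; split=> [|n].
  by rewrite /= (fE 1%N) ?msize1 //= reduce_low ?msize1 // mcoeff1 eqxx.
have sP j : msize (P n.+1 j 0) = n.+2 by case: mP => PS _; rewrite (PS _).1.
apply/matrixP => j k; rewrite (ord1 k) !mxE /= (fE n.+2) ?sP //.
by rewrite /= (reduce_low P d0 (n := n.+2)) ?sP // reduce_monic.
Qed.

Lemma rdim0 d : rdim d 0 = 1%N.
Proof. by rewrite /rdim add0n binn. Qed.

Lemma monom0 d (j : 'I_(rdim d 0)) : (0 < d)%N -> monom j = 0%MM.
Proof. by move=> d0; apply/eqP; rewrite -mdeg_eq0 mdeg_monom. Qed.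

Lemma monic_PS_0 (R : realType) (d : nat) (P : forall n, pvec R d n) :
  (0 < d)%N -> is_monic_PS P -> P 0%N = const_mx 1.
Proof.
move=> d0 [_ low]; apply/matrixP => j k; rewrite (ord1 k) mxE.
have := low 0%N j; rewrite leqn0 mmeasure_poly_eq0 !mxE monom0 //.
by rewrite mpolyX0 subr_eq0 => /eqP.
Qed.

Lemma gram00 (R : realType) (d : nat) (u : {scalar {mpoly R[d]}})
    (P : forall n, pvec R d n) :
  (0 < d)%N -> is_monic_PS P -> u 1 = 1 -> gram u P 0 0 = 1%:M.
Proof.
move=> d0 mP u1; rewrite /gram (monic_PS_0 d0 mP); apply/matrixP => j k.
rewrite !mxE big_ord1 !mxE mulr1 u1.
have -> : j = k by apply: (@monom_inj _ _ d0); rewrite !monom0.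
by rewrite eqxx.
Qed.

(** * Multiplication by a linear form, in coordinates *)

(** The matrix of multiplication by [\sum_i a_i x_i] from degree [n] to degree
    [n + 1]. *)
Definition mul_form (R : realType) (d : nat) (a : 'I_d -> R) n :
    'M[R]_(rdim d n, rdim d n.+1) := \sum_i a i *: Lmx R n i.

Lemma mul_form_Xvec (R : realType) (d : nat) (a : 'I_d -> R) n :
  mul_form a n *mp Xvec R d n.+1 = (\sum_i a i *: 'X_i) *: Xvec R d n.
Proof.
rewrite scaler_suml /pmulmx raddf_sum mulmx_suml; apply: eq_bigr => i _ /=.
rewrite map_mxZ -scalemxAl -/(pmulmx _ _) Lmx_Xvec scalerA.
by rewrite mul_mpolyC.
Qed.

(** Multiplying by [l] and by [x_i] in either order is the same. *)
Lemma mul_form_LmxC (R : realType) (d : nat) (a : 'I_d -> R) n i : (0 < d)%N ->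
  mul_form a n *m Lmx R n.+1 i = Lmx R n i *m mul_form a n.+1.
Proof.
move=> d0; apply: (pmulmx_Xvec_inj d0); rewrite !pmulmxA Lmx_Xvec mul_form_Xvec.
by rewrite !pmulmxZr mul_form_Xvec Lmx_Xvec !scalerA mulrC.
Qed.

(** Polynomials have no zero divisors. *)
Lemma row_free_mul_form (R : realType) (d : nat) (a : 'I_d -> R) n : (0 < d)%N ->
  mul_form a 0 != 0 -> row_free (mul_form a n).
Proof.
move=> d0 a0; apply: inj_row_free => v /(congr1 (fun K => K *mp Xvec R d n.+1)).
rewrite /= pmulmxA mul_form_Xvec pmulmxZr pmul0mx => lv0.
apply: (pmulmx_Xvec_inj d0); rewrite pmul0mx; apply/matrixP => j k.
have /matrixP /(_ j k)/eqP := lv0; rewrite !mxE mulf_eq0 => /orP[/eqP l0|/eqP //].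
case/eqP: a0; apply: (pmulmx_Xvec_inj d0).
by rewrite mul_form_Xvec l0 scale0r pmul0mx.
Qed.

(** Every monomial of degree [n + 1] is a variable times one of degree [n], so
    the matrices [Lmx R n i], stacked over [i], have full column rank. The two
    lemmas that follow are forms of this fact. *)
Lemma exists_row_Lmx (R : realType) (d n : nat) (k : 'I_(rdim d n.+1)) :
  (0 < d)%N -> exists i j, row j (Lmx R n i) = delta_mx 0 k.
Proof.
move=> d0.
have [i ki] : exists i, monom k i != 0%N.
  apply/existsP; rewrite -negb_forall; apply/negP => /forallP k0.
  have: monom k = 0%MM by apply/mnmP => i; rewrite mnm0E; apply/eqP.
  by move/(congr1 (@mdeg d)); rewrite mdeg_monom // mdeg0.
have ui : (U_(i) <= monom k)%MM by rewrite lep1mP.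
have [j jE] : exists j : 'I_(rdim d n), monom j = (monom k - U_(i))%MM.
  apply: monom_surj => //; apply/succn_inj.
  have := mdeg_monom k d0.
  by rewrite -{1}(submK ui) mdegD mdeg1 addn1.
exists i, j; apply/rowP => l.
by rewrite !mxE jE submK // eq_sym (inj_eq (@monom_inj _ _ d0)).
Qed.

Lemma mulmx_trLmx_inj (R : realType) (d m n : nat) (K K' : 'M[R]_(m, rdim d n.+1)) :
  (0 < d)%N -> (forall i, K *m (Lmx R n i)^T = K' *m (Lmx R n i)^T) -> K = K'.
Proof.
move=> d0 KK'; apply/trmx_inj/row_matrixP => k.
have [i [j ij]] := exists_row_Lmx R k d0.
rewrite !rowE -ij -!row_mul; congr row.
by apply: trmx_inj; rewrite !trmx_mul !trmxK.
Qed.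

Lemma submx_Lmx (R : realType) (d m n p : nat) (T : 'M[R]_(rdim d n.+1, p))
    (N : 'M[R]_(m, p)) :
  (0 < d)%N -> (forall i, (Lmx R n i *m T <= N)%MS) -> (T <= N)%MS.
Proof.
move=> d0 LN; apply/row_subP => k.
have [i [j ij]] := exists_row_Lmx R k d0.
by rewrite rowE -ij -row_mul (submx_trans (row_sub _ _)).
Qed.

(** As [rdim d 0 = 1], the matrix [N] is a single row, holding one coefficient
    for each variable. *)
Lemma linear_form_of_row (R : realType) (d : nat)
    (N : 'M[R]_(rdim d 0, rdim d 1)) :
  (0 < d)%N -> exists a : 'I_d -> R, N = mul_form a 0.
Proof.
move=> d0; have r0 : (0 < rdim d 0)%N by rewrite rdim0.
pose j0 := Ordinal r0.
exists (fun i => \sum_k (monom k == U_(i)%MM)%:R * N j0 k).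
apply/matrixP => j k; rewrite summxE.
have -> : j = j0 by apply: (@monom_inj _ _ d0); rewrite !monom0.
have /eqP : mdeg (monom k) = 1%N by rewrite mdeg_monom.
rewrite mdeg_eq1 => /existsP [i /eqP ki].
rewrite (bigD1 i) //= [X in _ + X]big1 => [|l li].
  rewrite !mxE monom0 // add0m ki eqxx mulr1 addr0 (bigD1 k) //= big1 => [|l lk].
    by rewrite ki eqxx mul1r addr0.
  by rewrite -ki (inj_eq (@monom_inj _ _ d0)) (negbTE lk) mul0r.
by rewrite !mxE monom0 // add0m ki eq_mnm1 (negbTE li) mulr0.
Qed.

(** * The nonsingular Gram matrices *)

(** By induction [N n] is a unit [G n] times [mul_form a n]. Substituting this
    into the relation for [D] shows that the rows of [N n.+1] span at least the
    multiples of the linear form; these have dimension [rdim d n.+1], the number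
    of rows of [N n.+1], so [N n.+1] factors in the same way. Cancelling the
    form from the relation leaves the one between [D], [G] and [Lmx]. *)
Lemma factor_through_form (R : realType) (d : nat) (a : 'I_d -> R)
    (N : forall n, 'M[R]_(rdim d n, rdim d n.+1))
    (D : forall n, 'I_d -> 'M[R]_(rdim d n, rdim d n.+1)) :
  (0 < d)%N -> N 0%N != 0 -> N 0%N = mul_form a 0 ->
  (forall n i, D n i *m N n.+1 = N n *m Lmx R n.+1 i) ->
  exists G : forall n, 'M[R]_(rdim d n),
    G 0%N = 1%:M /\ forall n i, D n i *m G n.+1 = G n *m Lmx R n i.
Proof.
move=> d0 N0 Na DN; pose T := mul_form a.
have freeT n : row_free (T n) by apply: row_free_mul_form; rewrite -?Na.
have [G GE] : exists G : forall n, 'M[R]_(rdim d n),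
    forall n K, N n = K *m T n -> G n = K.
  by exists (fun n => N n *m pinvmx (T n)) => n K ->; rewrite mulmxKp.
have NG n : N n = G n *m T n /\ G n \in unitmx.
  elim: n => [|n [NGn Gu]].
    by rewrite (GE 0%N 1%:M) ?mul1mx ?unitmx1.
  (* L_{n,i} T_{n+1} = T_n L_{n+1,i} = G_n^-1 N_n L_{n+1,i} = G_n^-1 D N_{n+1} *)
  have /submxP[K TK] : (T n.+1 <= N n.+1)%MS.
    apply: (submx_Lmx d0) => i; rewrite -mul_form_LmxC //.
    by rewrite -[mul_form a n](mulKmx Gu) -NGn -mulmxA -DN mulmxA submxMl.
  have Ku : K \in unitmx.
    rewrite -row_free_unit -row_leq_rank.
    have := freeT n.+1; rewrite -row_leq_rank => /leq_trans; apply.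
    by rewrite TK mxrankM_maxl.
  have NK : N n.+1 = invmx K *m T n.+1 by rewrite TK mulKmx.
  by rewrite (GE _ _ NK) unitmx_inv.
exists G; split=> [|n i]; first by apply: GE; rewrite mul1mx.
apply: (row_free_inj (freeT n.+1)).
by rewrite /= -!mulmxA -(NG n.+1).1 DN -mul_form_LmxC // mulmxA -(NG n).1.
Qed.

(** [G n] is the inverse of the transposed Gram matrix: the recurrence of the
    Gram matrices determines [gram u P n.+1 n.+1] from [gram u P n n] because
    the matrices [Lmx R n i] are jointly of full rank. *)
Lemma gram_unit (R : realType) (d : nat) (u : {scalar {mpoly R[d]}})
    (P : forall n, pvec R d n)
    (C : forall n, 'I_d -> 'M[R]_(rdim d n, rdim d n.-1))
    (G : forall n, 'M[R]_(rdim d n)) :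
  (0 < d)%N -> gram u P 0 0 = 1%:M -> G 0%N = 1%:M ->
  (forall n i, gram u P n.+1 n.+1 *m (Lmx R n i)^T = C n.+1 i *m gram u P n n) ->
  (forall n i, (C n.+1 i)^T *m G n.+1 = G n *m Lmx R n i) ->
  forall n, gram u P n n \in unitmx.
Proof.
move=> d0 H0 G0 HL CG n.
suff /mulmx1_unit[] : (G n)^T *m gram u P n n = 1%:M by [].
elim: n => [|n IH]; first by rewrite H0 G0 trmx1 mulmx1.
apply: (mulmx_trLmx_inj d0) => i; rewrite mul1mx -mulmxA HL mulmxA.
by rewrite -[_ *m C _ _]trmxK trmx_mul trmxK CG trmx_mul -mulmxA IH mulmx1.
Qed.

(** * The three term relation of the new system *)

(** The defect of the three term relation with coefficients [A], [B], [C]. *)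
Definition residual (R : realType) (d : nat) (P : forall n, pvec R d n)
    (A : forall n, 'I_d -> 'M[R]_(rdim d n, rdim d n.+1))
    (B : forall n, 'I_d -> 'M[R]_(rdim d n))
    (C : forall n, 'I_d -> 'M[R]_(rdim d n, rdim d n.-1)) n i : pvec R d n :=
  'X_i *: P n - (A n i *mp P n.+1 + B n i *mp P n + C n i *mp prevPS P n).

(** Polynomial identities that are linear in the vectors [A *mp P]. *)
Ltac pmulmx_ring := rewrite !(pmulmxDl, pmulmxDr, pmulNmx, pmulmxN, pmulmxA);
  repeat move: (pmulmx _ _) => ?;
  apply/matrixP => ? ?; rewrite !mxE; ring.

Lemma residual0 (R : realType) (d : nat)
    (Q P : forall n, pvec R d n)
    (At A : forall n, 'I_d -> 'M[R]_(rdim d n, rdim d n.+1))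
    (Bt B : forall n, 'I_d -> 'M[R]_(rdim d n))
    (Ct C : forall n, 'I_d -> 'M[R]_(rdim d n, rdim d n.-1))
    (M : forall n, 'M[R]_(rdim d n, rdim d n.-1)) :
  three_term Q At Bt Ct -> P 0%N = Q 0%N ->
  (forall n, Q n.+1 = P n.+1 + M n.+1 *mp P n) -> forall i,
  residual P A B C 0 i = (At 0%N i - A 0%N i) *mp P 1%N
    + (Bt 0%N i - mulMAprev M A 0 i + At 0%N i *m M 1%N - B 0%N i) *mp P 0%N.
Proof.
move=> tt P0 rec i; rewrite /residual {1}P0 tt /= !pmulmx0 rec -P0 subr0.
pmulmx_ring.
Qed.

(** Expand [x_i Q_{n+1}] in the system [P] through the relation of [Q], and
    separately through that of [P]. *)
Lemma residualS (R : realType) (d : nat)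
    (Q P : forall n, pvec R d n)
    (At A : forall n, 'I_d -> 'M[R]_(rdim d n, rdim d n.+1))
    (Bt B : forall n, 'I_d -> 'M[R]_(rdim d n))
    (Ct C : forall n, 'I_d -> 'M[R]_(rdim d n, rdim d n.-1))
    (M : forall n, 'M[R]_(rdim d n, rdim d n.-1)) :
  three_term Q At Bt Ct -> P 0%N = Q 0%N ->
  (forall n, Q n.+1 = P n.+1 + M n.+1 *mp P n) -> forall n i,
  residual P A B C n.+1 i + M n.+1 *mp residual P A B C n i =
      (At n.+1 i - A n.+1 i) *mp P n.+2
    + (Bt n.+1 i - mulMAprev M A n.+1 i + At n.+1 i *m M n.+2 - B n.+1 i)
        *mp P n.+1
    + (Ct n.+1 i - M n.+1 *m B n i + Bt n.+1 i *m M n.+1 - C n.+1 i) *mp P n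
    + (Ct n.+1 i *m M n - M n.+1 *m C n i) *mp prevPS P n.
Proof.
move=> tt P0 rec n i.
have prevQ : prevPS Q n.+1 = P n + M n *mp prevPS P n.
  by case: n => [|n] /=; rewrite ?pmulmx0 ?addr0 ?P0.
have XP : 'X_i *: P n.+1 = 'X_i *: Q n.+1 - M n.+1 *mp ('X_i *: P n).
  by rewrite pmulmxZr -scalerBr rec addrK.
rewrite /residual XP tt prevQ !rec /=.
pmulmx_ring.
Qed.

(** Pairing with [P n] isolates its coefficient when the other terms [V] are
    orthogonal to it. *)
Lemma OPS_coef_eq0 (R : realType) (d : nat) (u : {scalar {mpoly R[d]}})
    (P : forall n, pvec R d n) k n (K : 'M[R]_(k, rdim d n)) V :
  is_OPS u P -> map_mx u (V *m (P n)^T) = 0 -> K *mp P n + V = 0 -> K = 0.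
Proof.
move=> [_ _ Hu] V0 /(congr1 (fun W => map_mx u (W *m (P n)^T))).
rewrite /= mulmxDl map_mxD V0 addr0 gram_pmulmx mul0mx map_mx0 => KH.
by rewrite -[K](mulmxK (Hu n)) -/(gram u P n n) KH mul0mx.
Qed.

Lemma monic_PS_of_recurrence (R : realType) (d : nat)
    (Q P : forall n, pvec R d n)
    (M : forall n, 'M[R]_(rdim d n, rdim d n.-1)) :
  (0 < d)%N -> is_monic_PS Q -> P 0%N = Q 0%N ->
  (forall n, Q n.+1 = P n.+1 + M n.+1 *mp P n) -> is_monic_PS P.
Proof.
move=> d0 [_ lowQ] P0 rec; apply: (monic_PS_of_lead d0); elim=> [|n IH] j.
  by rewrite P0.
have -> : P n.+1 - Xvec R d n.+1 = (Q n.+1 - Xvec R d n.+1) - M n.+1 *mp P n.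
  by rewrite rec addrAC addrK.
apply/msize_leP => a na.
have -> (U V : pvec R d n.+1) : (U - V) j 0 = U j 0 - V j 0 by rewrite !mxE.
rewrite mcoeffB; have /msize_leP -> // := lowQ n.+1 j.
by have /msize_leP -> // := pmulmx_low (M n.+1) (msize_of_lead d0 IH) j; rewrite subr0.
Qed.

Theorem theorem3 (R : realType) (d : nat) (d_gt0 : (0 < d)%N)
    (Q : forall n, 'cV[{mpoly R[d]}]_(rdim d n))
    (At : forall n, 'I_d -> 'M[R]_(rdim d n, rdim d n.+1))
    (Bt : forall n, 'I_d -> 'M[R]_(rdim d n))
    (Ct : forall n, 'I_d -> 'M[R]_(rdim d n, rdim d n.-1))
    (Q_monic_OPS : is_monic_OPS Q)
    (Q_three_term : three_term Q At Bt Ct)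
    (M : forall n, 'M[R]_(rdim d n, rdim d n.-1))
    (rank_M1 : \rank (M 1%N) = 1%N)
    (P : forall n, 'cV[{mpoly R[d]}]_(rdim d n))
    (P_0 : P 0%N = Q 0%N)
    (P_rec : forall n, Q n.+1 = P n.+1 + M n.+1 *mp P n)
    (A : forall n, 'I_d -> 'M[R]_(rdim d n, rdim d n.+1))
    (B : forall n, 'I_d -> 'M[R]_(rdim d n))
    (C : forall n, 'I_d -> 'M[R]_(rdim d n, rdim d n.-1)) :
  (is_monic_OPS P /\ three_term P A B C) <->
  (forall i : 'I_d,
     [/\ forall n, M n.+2 *m C n.+1 i = Ct n.+2 i *m M n.+1,
         forall n, A n i = At n i /\ At n i = Lmx R n i,
         forall n, B n i = Bt n i - mulMAprev M A n i + At n i *m M n.+1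
       & forall n, C n.+1 i = Ct n.+1 i - M n.+1 *m B n i + Bt n.+1 i *m M n.+1]).
Proof.
have [Q_monic [ut Q_OPS]] := Q_monic_OPS.
have AtL := monic_three_term_lead d_gt0 Q_monic Q_three_term.
have res0 := residual0 A B C Q_three_term P_0 P_rec.
have resS := residualS A B C Q_three_term P_0 P_rec.
split=> [[[P_monic [u P_OPS]] P_three_term] i | rel].
  have AL := monic_three_term_lead d_gt0 P_monic P_three_term.
  have AAt n j : At n j - A n j = 0 by rewrite AtL AL subrr.
  have resid_eq0 n : residual P A B C n i = 0.
    by rewrite /residual P_three_term subrr.
  have orth n m : n != m -> gram u P n m = 0 by case: P_OPS => _ + _; apply.
  have relS n : [/\
      Bt n.+1 i - mulMAprev M A n.+1 i + At n.+1 i *m M n.+2 - B n.+1 i = 0,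
      Ct n.+1 i - M n.+1 *m B n i + Bt n.+1 i *m M n.+1 - C n.+1 i = 0
    & (Ct n.+1 i *m M n - M n.+1 *m C n i) *mp prevPS P n = 0].
    (* The terms in P (n + 1), P n and P (n - 1) are split off in this order. For
       n = 0 the last vector is 0, so only its product with the coefficient is
       known to vanish. *)
    have := resS n i.
    rewrite !resid_eq0 AAt pmul0mx pmulmx0 !add0r -addrA => /esym E.
    have prev_orth m : (n <= m)%N -> map_mx u (prevPS P n *m (P m)^T) = 0.
      case: n {E} => [|n] nm /=; first by rewrite mul0mx map_mx0.
      by apply: orth; rewrite neq_ltn nm.
    have E1 := OPS_coef_eq0 P_OPS _ E; rewrite E1 in E *; last first.
      rewrite mulmxDl map_mxD gram_pmulmx orth ?neq_ltn ?leqnn // mulmx0 add0r.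
      by rewrite -mulmxA map_mx_mpolyCM prev_orth ?mulmx0.
    rewrite pmul0mx add0r in E.
    have E2 := OPS_coef_eq0 P_OPS _ E; rewrite E2 in E *; last first.
      by rewrite -mulmxA map_mx_mpolyCM prev_orth ?mulmx0.
    by rewrite pmul0mx add0r in E.
  split=> n.
  - have [_ _ E] := relS n.+1.
    apply/esym/subr0_eq; apply: (OPS_coef_eq0 (n := n) (V := 0) P_OPS).
      by rewrite mul0mx map_mx0.
    by rewrite addr0.
  - by rewrite AtL AL.
  - case: n => [|n]; last by have [/subr0_eq <-] := relS n.
    have := res0 i; rewrite resid_eq0 AAt pmul0mx add0r => /esym E.
    apply/esym/subr0_eq; apply: (OPS_coef_eq0 (n := 0) (V := 0) P_OPS).
      by rewrite mul0mx map_mx0.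
    by rewrite addr0.
  - by have [_ /subr0_eq <-] := relS n.
have resid_eq0 n i : residual P A B C n i = 0.
  have [MC AE BE CE] := rel i.
  elim: n => [|n IH].
    by rewrite res0 (AE 0%N).1 -BE !subrr !pmul0mx addr0.
  have := resS n i; rewrite IH pmulmx0 addr0 => ->.
  rewrite (AE n.+1).1 -BE -CE !subrr !pmul0mx !add0r.
  by case: n {IH} => [|n] /=; rewrite ?pmulmx0 // MC subrr pmul0mx.
have P_three_term : three_term P A B C.
  by move=> n i; apply/eqP; rewrite -subr_eq0 -/(residual P A B C n i) resid_eq0.
have P_monic := monic_PS_of_recurrence d_gt0 Q_monic P_0 P_rec.
have [u [u1 uP]] := exists_dual_functional d_gt0 P_monic.
have orthP := three_term_orthogonal P_monic.1 uP P_three_term.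
split=> //; split=> //; exists u; split=> //; first exact: P_monic.1.
pose Ht n := gram ut Q n n.
have Htu n : Ht n \in unitmx by case: Q_OPS => _ _; apply.
have orthQ n m : n != m -> gram ut Q n m = 0 by case: Q_OPS => _ + _; apply.
have HtL := gram_three_term orthQ Q_three_term.
pose N n := (M n.+1)^T *m invmx (Ht n.+1).
have N0 : N 0%N != 0.
  apply/eqP => /(congr1 (fun K => K *m Ht 1%N)); rewrite mulmxKV // mul0mx.
  move/(congr1 trmx); rewrite trmxK trmx0 => M0.
  by move: rank_M1; rewrite M0 mxrank0.
have CN n i : (C n.+1 i)^T *m N n.+1 = N n *m Lmx R n.+1 i.
  have [MC _ _ _] := rel i.
  have CtE : Ct n.+2 i = Ht n.+2 *m (Lmx R n.+1 i)^T *m invmx (Ht n.+1).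
    by rewrite -AtL HtL mulmxK.
  rewrite mulmxA -trmx_mul MC CtE !trmx_mul trmxK trmx_inv !gram_tr -!mulmxA.
  by rewrite mulmxV // mulmx1 mulmxA.
have [a Na] := linear_form_of_row (N 0%N) d_gt0.
have [G [G0 CG]] := factor_through_form d_gt0 N0 Na CN.
apply: (gram_unit d_gt0 (gram00 d_gt0 P_monic u1) G0 _ CG) => n i.
have [_ AE _ _] := rel i.
by rewrite -(AE n).2 -(AE n).1 (gram_three_term orthP P_three_term).
Qed.
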